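(* Let $n\ge 1$ be an integer, let $T_1,\dots,T_n\in\{0,1\}$ be independent Bernoulli random variables with $P(T_i=1)=q_i\in[0,1]$ (the $q_i$ possibly distinct), let $\bar q=\frac1n\sum_{i=1}^n q_i$ and $n\bar T=\sum_{i=1}^n T_i$, and let $\alpha\in[0,1]$. With the statistics $\hat q^g_\alpha(k,n)$ and $\hat q^f_\alpha(k,n)$, $k\in\{0,\dots,n\}$, defined in the context, the following two inequalities hold: $$P\big(\bar q\ \ge\ \hat q^g_\alpha(n\bar T,n)\big)\ \ge\ 1-\alpha,$$ $$P\big(\bar q\ \le\ 1-\hat q^g_\alpha(n(1-\bar T),n)\big)\ \ge\ 1-\alpha .$$ Moreover, for $k\in\{0,\dots,n\}$, $\hat q^g_\alpha(k,n)=\hat q^f_\alpha(k,n)$ whenever either $k\le1$ or $\alpha\le\alpha^*(k,n)$; in particular, $\hat q^g_\alpha(k,n)=\hat q^f_\alpha(k,n)$ for all $k\in\{0,\dots,n\}$ when $\alpha\le 1/4$.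
   Context: For $a,b>0$ and $x\in[0,1]$, $I_x(a,b)=\frac{\Gamma(a+b)}{\Gamma(a)\Gamma(b)}\int_0^x t^{a-1}(1-t)^{b-1}\,dt$ is the regularized incomplete Beta function, and for $\alpha\in[0,1]$, $I^{-1}_\alpha(a,b)$ is its inverse in $x$, i.e. the unique $x\in[0,1]$ with $I_x(a,b)=\alpha$. For $1\le k\le n$ let $\alpha^*(k,n)=I_{(k-1)/n}(k,\,n-k+1)$. For $k\in\{0,\dots,n\}$ define $$\hat q^g_\alpha(k,n)=\begin{cases}0 & k=0\\ \frac kn-\frac{1-\alpha}{n(1-\alpha^*(k,n))} & k>0,\ \alpha^*(k,n)\le\alpha\le1\\ I^{-1}_\alpha(k,n-k+1) & k>0,\ 0\le\alpha\le\alpha^*(k,n)\end{cases}$$ (the last two branches agree at $\alpha=\alpha^*(k,n)$). For integers $0\le c\le n-1$, $0\le s\le c$ and $\alpha\in[0,1]$ let $$S_n(c,\alpha,s)=\frac{s+(n-s)\,I^{-1}_{1-\alpha}(c-s+1,\,n-c)}{n},\qquad S_n(c,\alpha)=\max_{0\le s\le c,\ s\in\mathbb Z}S_n(c,\alpha,s).$$ For $0\le d\le n-1$ let $\alpha^\dagger=\alpha^\dagger(d,n)=I_{d/n}(d+1,n-d)$ (so $\alpha^*(k,n)=\alpha^\dagger(k-1,n)$). For $-1\le d\le n-1$ and $\alpha\in[0,1]$ define $$\tilde f_\alpha(d,n)=\begin{cases}0 & d=-1\\ 1-S_n(n-d-1,\alpha) & d\ge0,\ \alpha^\dagger<\alpha\le1\\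 I^{-1}_\alpha(d+1,n-d) & d\ge0,\ 0\le\alpha\le\alpha^\dagger,\end{cases}$$ and $\hat q^f_\alpha(k,n)=\tilde f_\alpha(k-1,n)$ for $k\in\{0,1,\dots,n\}$. *)

(* Defs.v *)
From HB Require Import structures.
From mathcomp Require Import all_boot all_order all_algebra.
From mathcomp Require Import all_classical all_reals all_analysis.

Set Implicit Arguments.
Unset Strict Implicit.
Unset Printing Implicit Defensive.

Import Order.TTheory GRing.Theory Num.Theory.
Import numFieldNormedType.Exports.

Local Open Scope classical_set_scope.
Local Open Scope ring_scope.

Section incomplete_beta.
Context {R : realType}.
Implicit Types a b x alpha : R.

Definition gamma_fun a : R :=
  \int[lebesgue_measure]_(t in `[0, +oo[) (t `^ (a - 1) * expR (- t)).

Definition inc_beta x a b : R :=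
  gamma_fun (a + b) / (gamma_fun a * gamma_fun b) *
  \int[lebesgue_measure]_(t in `[0, x]) (t `^ (a - 1) * (1 - t) `^ (b - 1)).

(* For 0 < a, 0 < b and 0 <= alpha <= 1 the set below is a singleton; outside
   this range the value carries no meaning. *)
Definition inc_beta_inv alpha a b : R :=
  xget 0 [set x | 0 <= x <= 1 /\ inc_beta x a b = alpha].

End incomplete_beta.

Section statistics.
Context {R : realType}.
Implicit Types (alpha : R) (k n c s d : nat).

(* The arguments of inc_beta are computed in R, so that no truncated
   subtraction occurs in them. *)
Definition alpha_star k n : R :=
  inc_beta ((k%:R - 1) / n%:R) k%:R (n%:R - k%:R + 1).

(* The last two branches agree when alpha = alpha_star k n. *)
Definition qhat_g alpha k n : R :=
  if k == 0%N then 0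
  else if alpha_star k n <= alpha then
    k%:R / n%:R - (1 - alpha) / (n%:R * (1 - alpha_star k n))
  else inc_beta_inv alpha k%:R (n%:R - k%:R + 1).

Definition Sterm n c alpha s : R :=
  (s%:R + (n%:R - s%:R) *
    inc_beta_inv (1 - alpha) (c%:R - s%:R + 1) (n%:R - c%:R)) / n%:R.

(* The default value of the iterated maximum is one of its terms, so this is
   the maximum of the finite nonempty family indexed by s = 0, ..., c. *)
Definition Smax n c alpha : R :=
  \big[Num.max/Sterm n c alpha 0]_(0 <= s < c.+1) Sterm n c alpha s.

Definition alpha_dagger d n : R :=
  inc_beta (d%:R / n%:R) (d%:R + 1) (n%:R - d%:R).

(* Only -1 <= d <= n - 1 is meaningful: Negz 0 is -1, and n - d - 1 is then not
   truncated. *)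
Definition f_tilde alpha (d : int) n : R :=
  match d with
  | Negz _ => 0
  | Posz d =>
      if alpha_dagger d n < alpha then 1 - Smax n (n - d - 1)%N alpha
      else inc_beta_inv alpha (d%:R + 1) (n%:R - d%:R)
  end.

Definition qhat_f alpha k n : R := f_tilde alpha (k%:Z - 1) n.

End statistics.

(* The product rule is required over every subfamily J. *)
Definition mutually_independent d (Omega : measurableType d) (R : realType)
    (P : probability Omega R) d' (E : measurableType d') (I : finType)
    (X : I -> {RV P >-> E}) : Prop :=
  forall (J : {set I}) (B : I -> set E),
    (forall i, i \in J -> measurable (B i)) ->
    P (\bigcap_(i in [set` J]) (X i @^-1` B i)) =
      (\prod_(i in J) P (X i @^-1` B i))%E.

(* The number of indices i with T_i = 1, that is n times the sample mean. *)
Definition successes (Omega : Type) n (X : 'I_n -> Omega -> bool)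
    (w : Omega) : nat := (\sum_(i < n) X i w)%N.

(* Main.v *)
Require Import Defs.
From mathcomp Require Import all_boot all_order all_algebra.
From mathcomp Require Import all_classical all_reals all_analysis.
From mathcomp Require Import ring lra.
Import Order.TTheory GRing.Theory Num.Theory.
Import numFieldNormedType.Exports.
Local Open Scope classical_set_scope.
Local Open Scope ring_scope.

(**
Let K be the number of successes, with generating polynomial
prod_i (1 - q_i + q_i X), and lambda = sum_i q_i its mean.  By Hoeffding,
P(K <= k) >= P(Bin(n, lambda / n) <= k) whenever lambda <= k: a minimiser of
P(K <= k) at fixed mean which in addition has least sum of squares has all its
entries in {0, a, 1}, and comparing two distinct entries reduces the claim to
the fact that binomial weights do not increase beyond the mean.  For
k <= lambda <= k + 1, P(K <= k) >= (k + 1 - lambda) P(Bin(n, k / n) <= k):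
both sides are affine in each q_i, so one can move one entry at a time until
it is 0 or 1, or lambda is k (Hoeffding) or k + 1 (trivial).  As
I_x(k + 1, n - k) = P(Bin(n, x) > k), these two bounds say exactly that
P(K >= k) <= alpha as soon as the mean q_i is below the statistic at k;
coverage follows by taking the least such k.  Finally alpha^*(k, n) >= 1/4 for
k >= 2, because Hoeffding's inequality applied to a binomial sample enlarged by
a sure failure or a sure success shows that alpha^* does not decrease from
(k, n) to (k, n + 1) and to (k + 1, n + 1), and alpha^*(2, 2) = 1/4.
*)

(** * The regularized incomplete Beta function at integers *)

(** The bound e^x >= x^(m+1)/(m+1)! makes the product at most (m+1)!/x. *)
Lemma cvg_expn_expRN (R : realType) m :
  (x ^+ m * expR (- x) : R) @[x --> +oo] --> 0.
Proof.
apply/cvgrPdist_le => e e0; near=> x.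
have x0 : 0 < x by near: x; apply: nbhs_pinfty_gt; exact: num_real.
rewrite sub0r normrN ger0_norm ?mulr_ge0 ?expR_ge0 ?exprn_ge0 ?(ltW x0)//.
rewrite expRN ler_pdivrMr ?expR_gt0//.
apply: (@le_trans _ _ (e * (x ^+ m.+1 / m.+1`!%:R))).
  rewrite (_ : e * _ = e * x / m.+1`!%:R * x ^+ m); last by rewrite exprS; ring.
  rewrite ler_peMl ?exprn_ge0 ?(ltW x0)//.
  rewrite ler_pdivlMr ?ltr0n ?fact_gt0// mul1r mulrC.
  rewrite -ler_pdivrMr//; near: x; apply: nbhs_pinfty_ge; exact: num_real.
rewrite ler_pM2l//; apply: le_trans (expR_ge1Dxn m (ltW x0)).
by rewrite lerDr ler01.
Unshelve. all: by end_near. Qed.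

(** Integration by parts gives the recursion on m. The primitive is normalised to vanish at
    infinity, so that its value at 0 is minus the Gamma integral. *)
Lemma primitive_expn_expRN (R : realType) m : exists F : R -> R,
  [/\ forall x : R, is_derive x (1 : R) F (x ^+ m * expR (- x)),
      F x @[x --> +oo] --> 0 & F 0 = - m`!%:R].
Proof.
elim: m => [|m [F [dF Foo F0]]].
  exists (fun x => - expR (- x)); split => [x||].
  - apply: is_derive_eq; rewrite expr0 /GRing.scale /=; ring.
  - by rewrite -[X in _ --> X]oppr0; apply: cvgN; exact: cvgr_expR.
  - by rewrite oppr0 expR0.
exists (fun x => - (x ^+ m.+1 * expR (- x)) + m.+1%:R * F x); split => [x||].
- have dE : is_derive x (1 : R) (fun y : R => expR (- y)) (- expR (- x)).
    by apply: is_derive_eq; rewrite /GRing.scale /= mulrN1.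
  rewrite (_ : (fun _ => _) = - (id ^+ m.+1 * (fun y : R => expR (- y))) + m.+1%:R \*: F);
    last by apply/funext => y; rewrite /= !fctE.
  apply: is_derive_eq; rewrite /GRing.scale /= fctE; ring.
- rewrite -[X in _ --> X](_ : - 0 + m.+1%:R * 0 = 0 :> R); last by rewrite mulr0 oppr0 addr0.
  apply: cvgD; first by apply: cvgN; exact: cvg_expn_expRN.
  exact: cvgMr.
- by rewrite expr0n mul0r oppr0 add0r F0 mulrN factS natrM.
Qed.

Lemma gamma_fun_nat (R : realType) m : gamma_fun (m.+1%:R : R) = m`!%:R.
Proof.
have [F [dF Foo F0]] := primitive_expn_expRN R m.
rewrite /gamma_fun.
transitivity (\int[lebesgue_measure]_(x in `[0, +oo[) (x ^+ m * expR (- x) : R)).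
  apply: eq_Rintegral => x; rewrite inE/= in_itv/= andbT => x0.
  by rewrite -natr1 addrK powR_mulrn.
rewrite (@Rintegral_ge0_continuous_FTC2y _ _ F _ 0) ?F0 ?sub0r ?opprK//.
- by move=> x x0; rewrite mulr_ge0 ?expR_ge0 ?exprn_ge0.
- apply: continuous_subspaceT => x; apply: cvgM; first exact: exprn_continuous.
  apply: continuous_comp; first exact: opp_continuous.
  exact: continuous_expR.
- apply: cvg_at_right_filter.
  have /derivable1_diffP/differentiable_continuous cF : derivable F 0 1 by [].
  by rewrite -F0; exact: cF.
- by move=> x _; rewrite derive1E derive_val.
Qed.

(** * Generating polynomials and binomial tails *)

Definition bern_pgf {R : realType} (a : R) : {poly R} := (1 - a)%:P + a *: 'X.

(** For the generating polynomial of a count K this is P(K < k); hence P(K <= k) carries the index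
    [k.+1]. *)
Definition coef_below {R : realType} k (p : {poly R}) : R := \sum_(j < k) p`_j.

(* P(Bin(n, x) < k) *)
Definition binom_lt {R : realType} k n (x : R) : R :=
  coef_below k (bern_pgf x ^+ n).

Lemma coef_below0 (R : realType) (p : {poly R}) : coef_below 0 p = 0.
Proof. exact: big_ord0. Qed.

Lemma coef_belowS (R : realType) k (p : {poly R}) :
  coef_below k.+1 p = coef_below k p + p`_k.
Proof. exact: big_ord_recr. Qed.

Lemma coef_bern_pgfM (R : realType) a (p : {poly R}) j :
  (bern_pgf a * p)`_j = (1 - a) * p`_j + a * (if j is j'.+1 then p`_j' else 0).
Proof.
rewrite /bern_pgf mulrDl coefD coefCM -scalerAl coefZ coefXM.
by case: j.
Qed.

(** Conditioning on one trial. At [k = 0] the truncated [k.-1] is harmless, all sums being empty. *)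
Lemma coef_below_bernM (R : realType) k a (p : {poly R}) :
  coef_below k (bern_pgf a * p) =
  (1 - a) * coef_below k p + a * coef_below k.-1 p.
Proof.
elim: k => [|k IH]; first by rewrite !coef_below0 !mulr0 addr0.
rewrite coef_belowS IH coef_bern_pgfM coef_belowS.
case: k {IH} => [|k]; first by rewrite !coef_below0; ring.
rewrite /= !coef_belowS; ring.
Qed.

Lemma coef_below1 (R : realType) k : coef_below k.+1 1 = 1 :> R.
Proof.
elim: k => [|k IH]; first by rewrite coef_belowS coef_below0 add0r coef1.
by rewrite coef_belowS IH coef1 addr0.
Qed.

Lemma coef_bern_pgfX (R : realType) (x : R) n k : (k <= n)%N ->
  (bern_pgf x ^+ n)`_k = 'C(n, k)%:R * (x ^+ k * (1 - x) ^+ (n - k)).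
Proof.
move=> kn; rewrite /bern_pgf exprDn coef_sum.
rewrite (bigD1 (inord k)) //= inordK ?ltnS// big1 ?addr0 => [|i ik].
  by rewrite coefMn exprZn -rmorphXn/= coefCM coefZ coefXn eqxx mulr1
    mulr_natl [x ^+ k * _]mulrC.
rewrite coefMn exprZn -rmorphXn/= coefCM coefZ coefXn.
rewrite (_ : k == i = false) ?mulr0 ?mul0rn//; apply/negP => /eqP ki.
by move: ik; rewrite ki inord_val eqxx.
Qed.

Lemma coef_bern_pgfX_ge0 (R : realType) (x : R) n k : 0 <= x <= 1 ->
  0 <= (bern_pgf x ^+ n)`_k.
Proof.
move=> /andP[x0 x1]; elim: n k => [|n IH] k; first by rewrite expr0 coef1 ler0n.
rewrite exprS coef_bern_pgfM addr_ge0 ?mulr_ge0 ?subr_ge0//.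
by case: k.
Qed.

(** Induction on the number of trials, differentiating the recursion that conditions on one trial.
    For k <= n the result is minus the Beta(k + 1, n - k + 1) density. *)
Lemma is_derive_binom_lt (R : realType) k n (x : R) :
  is_derive x (1 : R) (@binom_lt R k.+1 n.+1)
    (- n.+1%:R * (bern_pgf x ^+ n)`_k).
Proof.
have E m l : @binom_lt R l m.+1 =
    (fun y => (1 - y) * binom_lt l m y + y * binom_lt l.-1 m y).
  by apply/funext => y; rewrite /binom_lt exprS coef_below_bernM.
elim: n k => [|n IH] k.
  rewrite (_ : binom_lt k.+1 1 =
      cst 1 + (coef_below k 1 - 1) \*: (id : R -> R)); last first.
    apply/funext => y; rewrite E /binom_lt /= expr0 coef_below1 fctE
      -[X in _ = 1 + X]/((coef_below k 1 - 1) * y).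
    ring.
  apply: is_derive_eq; rewrite expr0 -(coef_below1 R k) coef_belowS /GRing.scale/=.
  ring.
rewrite E (_ : (fun _ => _) =
    (cst 1 - id) * binom_lt k.+1 n.+1 + id * binom_lt k n.+1); last first.
  by apply/funext => y; rewrite !fctE.
(* The induction hypothesis speaks of successor thresholds only; threshold 0 gives the constant
   0. *)
have dk : is_derive x (1 : R) (@binom_lt R k n.+1)
    (- n.+1%:R * (if k is k'.+1 then (bern_pgf x ^+ n)`_k' else 0)).
  case: k => [|k]; last exact: IH.
  rewrite mulr0 (_ : binom_lt 0 n.+1 = cst 0); first exact: is_derive_cst.
  by apply/funext => y; rewrite /binom_lt coef_below0.
apply: is_derive_eq.
rewrite !fctE /GRing.scale/= exprS coef_bern_pgfM.
have -> : binom_lt k.+1 n.+1 x = binom_lt k n.+1 x + (bern_pgf x ^+ n.+1)`_k.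
  by rewrite /binom_lt coef_belowS.
rewrite exprS coef_bern_pgfM -[n.+2%:R]natr1.
set c := (if k is _.+1 then _ else _); ring.
Qed.

Lemma derivable_binom_lt (R : realType) k n (x : R) :
  derivable (binom_lt k.+1 n.+1 : R -> R) x 1.
Proof. by have := is_derive_binom_lt R k n x. Qed.

Lemma continuous_binom_lt (R : realType) k n :
  continuous (binom_lt k.+1 n.+1 : R -> R).
Proof.
move=> x; apply: differentiable_continuous.
exact/derivable1_diffP/derivable_binom_lt.
Qed.

Lemma binom_lt_0 (R : realType) k n : binom_lt k.+1 n (0 : R) = 1.
Proof.
by rewrite /binom_lt /bern_pgf scale0r addr0 subr0 expr1n coef_below1.
Qed.

Lemma binom_lt_1 (R : realType) k n : (k <= n)%N -> binom_lt k n (1 : R) = 0.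
Proof.
move=> kn; rewrite /binom_lt /bern_pgf subrr add0r scale1r /coef_below big1// => i _.
by rewrite coefXn ltn_eqF// (leq_trans _ kn).
Qed.

Lemma binom_lt_decr (R : realType) k n (x y : R) : (k <= n)%N ->
  0 <= x -> x < y -> y <= 1 -> binom_lt k.+1 n.+1 y < binom_lt k.+1 n.+1 x.
Proof.
move=> kn; apply: (@ltr0_derive1_decr _ (binom_lt k.+1 n.+1) 0 1).
- by move=> z _; exact: derivable_binom_lt.
- move=> z; rewrite in_itv/= => /andP[z0 z1].
  have dz := is_derive_binom_lt R k n z.
  rewrite derive1E derive_val coef_bern_pgfX// mulNr oppr_lt0.
  by rewrite !mulr_gt0 ?exprn_gt0 ?subr_gt0 ?ltr0n ?bin_gt0.
- exact/continuous_subspaceT/continuous_binom_lt.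
Qed.

Lemma binom_lt_anti (R : realType) k n (x y : R) : (k <= n)%N ->
  0 <= x -> x <= y -> y <= 1 -> binom_lt k.+1 n.+1 y <= binom_lt k.+1 n.+1 x.
Proof.
move=> kn x0; rewrite le_eqVlt => /predU1P[->//|xy] y1.
exact/ltW/binom_lt_decr.
Qed.

Lemma binom_lt_inj (R : realType) k n (x y : R) : (k <= n)%N ->
  0 <= x <= 1 -> 0 <= y <= 1 ->
  binom_lt k.+1 n.+1 x = binom_lt k.+1 n.+1 y -> x = y.
Proof.
move=> kn /andP[x0 x1] /andP[y0 y1] xy.
have [h|h|//] := ltgtP x y.
- by have := binom_lt_decr _ _ _ _ _ kn x0 h y1; rewrite xy ltxx.
- by have := binom_lt_decr _ _ _ _ _ kn y0 h x1; rewrite xy ltxx.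
Qed.

(** The Gamma quotient is (n + 1) C(n, k), so the normalised integrand is the opposite of the
    derivative of the binomial tail. *)
Lemma inc_beta_nat (R : realType) k n (x : R) : (k <= n)%N -> 0 <= x <= 1 ->
  inc_beta x k.+1%:R (n - k).+1%:R = 1 - binom_lt k.+1 n.+1 x.
Proof.
move=> kn /andP[x0 x1]; rewrite /inc_beta.
have -> : k.+1%:R + (n - k).+1%:R = n.+2%:R :> R.
  by rewrite -natrD addSn addnS subnKC.
rewrite !gamma_fun_nat.
pose f := fun t : R => t ^+ k * (1 - t) ^+ (n - k).
pose c : R := n.+1%:R * 'C(n, k)%:R.
have c0 : c != 0 by rewrite mulf_neq0// pnatr_eq0 -lt0n bin_gt0.
have -> : n.+1`!%:R / (k`!%:R * (n - k)`!%:R) = c :> R.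
  have f0 m : m`!%:R != 0 :> R by rewrite pnatr_eq0 -lt0n fact_gt0.
  by rewrite factS -(bin_fact kn) !natrM /c mulrA mulfK// mulf_neq0.
transitivity (c * \int[lebesgue_measure]_(t in `[0, x]) f t).
  congr (_ * _); apply: eq_Rintegral => t; rewrite inE/= in_itv/= => /andP[t0 tx].
  rewrite -[k.+1%:R]natr1 -[(n - k).+1%:R]natr1 !addrK !powR_mulrn//.
  by rewrite subr_ge0 (le_trans tx).
(* The fundamental theorem of calculus is applied on a nondegenerate interval, so x = 0 is treated
   apart. *)
move: x0; rewrite le_eqVlt => /predU1P[<-|x0].
  by rewrite set_itv1 Rintegral_set1 mulr0 binom_lt_0 subrr.
rewrite /Rintegral (@continuous_FTC2 _ _ (- c^-1 \*: binom_lt k.+1 n.+1))//=.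
- rewrite binom_lt_0 /GRing.scale/=; field.
  exact: c0.
- by apply: continuous_subspaceT; exact: (@continuous_XMonemX R k (n - k)).
- have cF : continuous (- c^-1 \*: (binom_lt k.+1 n.+1 : R -> R)).
    by move=> t; apply: cvgZr; exact: continuous_binom_lt.
  split => [t _||].
  + by apply: derivableZ; exact: derivable_binom_lt.
  + exact/cvg_at_right_filter/cF.
  + exact/cvg_at_left_filter/cF.
- move=> t _; have dt := is_derive_binom_lt R k n t.
  rewrite derive1E derive_val coef_bern_pgfX// /GRing.scale/=.
  by rewrite !mulNr mulrN opprK [n.+1%:R * (_ * _)]mulrA -/c mulKf.
Qed.

(** By the intermediate value theorem the set searched by [xget] is inhabited, so [xget] returns a
    genuine solution rather than its default. *)
Lemma inc_beta_invP (R : realType) k n (alpha : R) : (k <= n)%N ->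
  0 <= alpha <= 1 ->
  0 <= inc_beta_inv alpha k.+1%:R (n - k).+1%:R <= 1 /\
  1 - binom_lt k.+1 n.+1 (inc_beta_inv alpha k.+1%:R (n - k).+1%:R) = alpha.
Proof.
move=> kn /andP[a0 a1].
have [x] : exists2 x : R, x \in `[0, 1] & binom_lt k.+1 n.+1 x = 1 - alpha.
  apply: IVT => //; first exact/continuous_subspaceT/continuous_binom_lt.
  rewrite binom_lt_0 binom_lt_1 ?ltnS// min_r ?max_l ?ler01//.
  by rewrite subr_ge0 a1 lerBlDr lerDl.
rewrite in_itv/= => x01 xE.
rewrite /inc_beta_inv; case: xgetP => [y _ [y01]|/(_ x)[]].
  by rewrite inc_beta_nat.
by split=> //; rewrite inc_beta_nat// xE subKr.
Qed.

(** * Hoeffding's inequality *)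

Definition pbin_pgf {R : realType} {n} (q : 'I_n -> R) : {poly R} :=
  \prod_(i < n) bern_pgf (q i).

Definition update2 {R : realType} {n} (q : 'I_n -> R) (i j : 'I_n) (a b : R) :=
  fun l => if l == i then a else if l == j then b else q l.

Lemma big_update2 (R : realType) (S : Type) (idx : S) (op : Monoid.com_law idx)
    n (q : 'I_n -> R) (F : R -> S) i j a b : i != j ->
  \big[op/idx]_(l < n) F (update2 q i j a b l) =
  op (F a) (op (F b) (\big[op/idx]_(l < n | (l != i) && (l != j)) F (q l))).
Proof.
move=> ij; rewrite (bigD1 i)//= (bigD1 j) 1?eq_sym//= /update2 eqxx eq_sym.
rewrite (negbTE ij) eqxx; congr (op _ (op _ _)).
by apply: eq_bigr => l /andP[/negbTE-> /negbTE->].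
Qed.

Lemma update2_id (R : realType) n (q : 'I_n -> R) i j : update2 q i j (q i) (q j) = q.
Proof.
by apply/funext => l; rewrite /update2; case: eqP => [->//|_]; case: eqP => [->|].
Qed.

(** Written so as to display the dependence on [a + b] and [a * b]: at fixed sum only the last term
    varies. *)
Lemma coef_below_bernM2 (R : realType) k (a b : R) p :
  coef_below k.+2 (bern_pgf a * (bern_pgf b * p)) =
  coef_below k.+2 p - (a + b) * p`_k.+1 + a * b * (p`_k.+1 - p`_k).
Proof. by rewrite !coef_below_bernM /= !coef_belowS; ring. Qed.

Lemma continuous_pointwiseD (R : realType) (T : topologicalType) (f g : T -> R) :
  continuous f -> continuous g -> continuous (fun x => f x + g x).
Proof. by move=> cf cg x; exact: cvgD (cf x) (cg x). Qed.

Lemma continuous_pointwiseM (R : realType) (T : topologicalType) (f g : T -> R) :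
  continuous f -> continuous g -> continuous (fun x => f x * g x).
Proof. by move=> cf cg x; exact: cvgM (cf x) (cg x). Qed.

Lemma continuous_pointwise_onem (R : realType) (T : topologicalType) (f : T -> R) :
  continuous f -> continuous (fun x => 1 - f x).
Proof. by move=> cf x; apply: cvgB (cf x); exact: cvg_cst. Qed.

(** Stated over a list of indices so that induction can remove one factor at a time. *)
Lemma continuous_coef_pbin (R : realType) n (s : seq 'I_n) j :
  continuous (fun v : 'rV[R]_n => (\prod_(i <- s) bern_pgf (v ord0 i))`_j).
Proof.
elim: s j => [|i s IH] j.
  rewrite (_ : (fun _ => _) = cst (1 : {poly R})`_j); first by move=> v; exact: cst_continuous.
  by apply/funext => v; rewrite big_nil.
rewrite (_ : (fun _ => _) = (fun v : 'rV[R]_n =>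
  (1 - v ord0 i) * (\prod_(l <- s) bern_pgf (v ord0 l))`_j + v ord0 i *
  (if j is j'.+1 then (\prod_(l <- s) bern_pgf (v ord0 l))`_j' else 0))); last first.
  by apply/funext => v; rewrite big_cons coef_bern_pgfM.
have ci : continuous (fun v : 'rV[R]_n => v ord0 i) by exact: coord_continuous.
apply: continuous_pointwiseD; apply: continuous_pointwiseM => //.
- exact: continuous_pointwise_onem.
- by case: j => [|j]; [exact: cst_continuous|exact: IH].
Qed.

Lemma continuous_coef_below_pbin (R : realType) n k :
  continuous (fun v : 'rV[R]_n => coef_below k (pbin_pgf (v ord0))).
Proof.
elim: k => [|k IH].
  rewrite (_ : (fun _ => _) = cst 0); first by move=> v; exact: cst_continuous.
  by apply/funext => v; rewrite coef_below0.
rewrite (_ : (fun _ => _) = (fun v : 'rV[R]_n => coef_below k (pbin_pgf (v ord0)) +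
  (pbin_pgf (v ord0))`_k)); last by apply/funext => v; rewrite coef_belowS.
exact: continuous_pointwiseD IH (continuous_coef_pbin _ _ _ _).
Qed.

Lemma continuous_rowsum (R : realType) n (F : R -> R) : continuous F ->
  continuous (fun v : 'rV[R]_n => \sum_(i < n) F (v ord0 i)).
Proof.
move=> cF; elim: (index_enum _) => [|i s IH].
  rewrite (_ : (fun _ => _) = cst 0); first by move=> v; exact: cst_continuous.
  by apply/funext => v; rewrite big_nil.
rewrite (_ : (fun _ => _) = (fun v : 'rV[R]_n => F (v ord0 i) +
  \sum_(l <- s) F (v ord0 l))); last by apply/funext => v; rewrite big_cons.
apply: continuous_pointwiseD IH => v.
apply: (@continuous_comp _ _ _ (fun v : 'rV[R]_n => v ord0 i)); last exact: cF.
exact: coord_continuous.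
Qed.

Definition unit_box {R : realType} {n} (q : 'I_n -> R) := forall i, 0 <= q i <= 1.

(** Two successive minimisations on compact sets: first the probability on the slice of the cube
    with prescribed sum, then the sum of squares among the minimisers. The second one breaks
    ties. *)
Lemma exists_extremal (R : realType) n k (q : 'I_n -> R) : unit_box q ->
  exists v : 'I_n -> R,
  [/\ unit_box v, \sum_i v i = \sum_i q i,
      coef_below k (pbin_pgf v) <= coef_below k (pbin_pgf q) &
      forall w : 'I_n -> R, unit_box w -> \sum_i w i = \sum_i q i ->
        coef_below k (pbin_pgf v) <= coef_below k (pbin_pgf w) /\
        (coef_below k (pbin_pgf w) <= coef_below k (pbin_pgf v) ->
         \sum_i (v i) ^+ 2 <= \sum_i (w i) ^+ 2)].
Proof.
move=> q01.
pose f := fun v : 'rV[R]_n => coef_below k (pbin_pgf (v ord0)).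
pose sm := fun v : 'rV[R]_n => \sum_(i < n) v ord0 i.
have csm : continuous sm by apply: (@continuous_rowsum R n id) => x; exact: cvg_id.
have cf : continuous f by exact: continuous_coef_below_pbin.
pose A := [set v : 'rV[R]_n | forall i, (`[0, 1]%classic : set R) (v ord0 i)] `&`
          sm @^-1` [set \sum_i q i].
have cA : compact A.
  apply: compact_closedI.
    by apply: (@rV_compact R n (fun=> `[0, 1]%classic)) => i; exact: segment_compact.
  by apply: preimage_closed => //; exact: closed_eq.
have rowE (w : 'I_n -> R) : (\row_l w l) ord0 = w.
  by apply/funext => l; rewrite mxE.
have rowA (w : 'I_n -> R) : unit_box w -> \sum_i w i = \sum_i q i -> A (\row_l w l).
  move=> w01 wq; split => [i|].
    by rewrite /= in_itv/= rowE.
  by rewrite /sm/= rowE.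
have [|c cinA cmin] := EVT_min_rV _ cA (continuous_subspaceT cf).
  by exists (\row_l q l); exact: rowA.
have fminA (w : 'I_n -> R) : unit_box w -> \sum_i w i = \sum_i q i ->
    f c <= coef_below k (pbin_pgf w).
  move=> w01 wq; have := cmin (\row_l w l); rewrite /f rowE; apply.
  by rewrite inE; exact: rowA.
(* The minimisers form a sublevel set of a continuous function, hence a closed subset of [A]. *)
pose M := A `&` f @^-1` [set x | x <= f c].
have cM : compact M.
  by apply: compact_closedI => //; apply: preimage_closed => //; exact: closed_le.
have cg : continuous (fun v : 'rV[R]_n => \sum_(i < n) (v ord0 i) ^+ 2).
  by apply: (@continuous_rowsum R n (fun x => x ^+ 2)) => x; exact: exprn_continuous.
have [|v vinM vmin] := EVT_min_rV _ cM (continuous_subspaceT cg).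
  by exists c; split; [rewrite -inE|rewrite /=].
move: vinM; rewrite inE => -[[v01 vq] /= fvc].
exists (v ord0); split => //.
- by apply: (le_trans fvc); exact: fminA.
- move=> w w01 wq; split; first by apply: (le_trans fvc); exact: fminA.
  move=> wv; have := vmin (\row_l w l).
  rewrite rowE; apply; rewrite inE; split; first exact: rowA.
  by rewrite /= /f rowE (le_trans wv).
Qed.

Lemma coef_bern_pgfX_gt (R : realType) (a : R) n j : (n < j)%N ->
  (bern_pgf a ^+ n)`_j = 0.
Proof.
move=> nj; apply: nth_default; apply: leq_trans nj.
apply: leq_trans (size_poly_exp_leq _ _) _; rewrite ltnS -[leqRHS]mul1n leq_mul2r.
have : (size (bern_pgf a) <= 2)%N.
  rewrite (leq_trans (size_polyD _ _))// geq_max (leq_trans (size_polyC_leq1 _))//.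
  by rewrite (leq_trans (size_scale_leq _ _))// size_polyX.
by case: (size _) => [|[|[|]]]//= _; rewrite orbT.
Qed.

(** The ratio of the two weights is (n - j) a / ((j + 1) (1 - a)), which is at most 1 exactly when
    (n + 1) a <= j + 1. *)
Lemma coef_bern_pgfX_nincr (R : realType) (a : R) n j : 0 <= a <= 1 ->
  n.+1%:R * a <= j.+1%:R ->
  (bern_pgf a ^+ n)`_j.+1 <= (bern_pgf a ^+ n)`_j.
Proof.
move=> a01 naj; have [nj|jn] := leqP n j.
  by rewrite coef_bern_pgfX_gt ?coef_bern_pgfX_ge0.
have /andP[a0 a1] := a01.
rewrite !coef_bern_pgfX ?(ltnW jn)// subnS.
have [m njm] : exists m, (n - j = m.+1)%N by exists (n - j).-1; rewrite prednK// subn_gt0.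
rewrite njm /= exprSr exprS.
have -> : 'C(n, j.+1)%:R * (a ^+ j * a * (1 - a) ^+ m) =
    ('C(n, j.+1)%:R * a) * (a ^+ j * (1 - a) ^+ m) by ring.
have -> : 'C(n, j)%:R * (a ^+ j * ((1 - a) * (1 - a) ^+ m)) =
    ('C(n, j)%:R * (1 - a)) * (a ^+ j * (1 - a) ^+ m) by ring.
apply: ler_wpM2r; first by rewrite mulr_ge0 ?exprn_ge0 ?subr_ge0.
(* Multiplying by j + 1 allows (j + 1) C(n, j + 1) = (n - j) C(n, j) to be used. *)
rewrite -(ler_pM2l (ltr0Sn R j)) mulrA -natrM mul_bin_left njm natrM mulrA.
rewrite [m.+1%:R * _]mulrC -!mulrA [leRHS]mulrCA.
apply: ler_wpM2l => //.
have nE : n%:R = m.+1%:R + j%:R :> R by rewrite -natrD -njm subnK// ltnW.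
move: naj; rewrite -natr1 nE -[j.+1%:R]natr1; lra.
Qed.

(* With the sum of the two entries fixed, the probability is affine in their
   product, with slope [p`_k.+1 - p`_k] where p is the generating polynomial of
   the other trials. *)
Lemma extremal_pair (R : realType) n k (q v : 'I_n -> R) i j :
  unit_box v -> \sum_l v l = \sum_l q l ->
  (forall w : 'I_n -> R, unit_box w -> \sum_l w l = \sum_l q l ->
        coef_below k.+2 (pbin_pgf v) <= coef_below k.+2 (pbin_pgf w) /\
        (coef_below k.+2 (pbin_pgf w) <= coef_below k.+2 (pbin_pgf v) ->
         \sum_l (v l) ^+ 2 <= \sum_l (w l) ^+ 2)) ->
  v i < v j ->
  let p := \prod_(l < n | (l != i) && (l != j)) bern_pgf (v l) in
  (v i = 0 \/ v j = 1) /\ p`_k < p`_k.+1.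
Proof.
move=> v01 vq vmin vij p; set D := p`_k.+1 - p`_k.
have ij : i != j by apply/eqP => ij; move: vij; rewrite ij ltxx.
have min2 a b : 0 <= a <= 1 -> 0 <= b <= 1 -> a + b = v i + v j ->
    v i * v j * D <= a * b * D /\
    (a * b * D <= v i * v j * D -> v i ^+ 2 + v j ^+ 2 <= a ^+ 2 + b ^+ 2).
  move=> a01 b01 abE.
  have E c d : coef_below k.+2 (pbin_pgf (update2 v i j c d)) =
      coef_below k.+2 p - (c + d) * p`_k.+1 + c * d * D.
    by rewrite /pbin_pgf (big_update2 _ _ _ _ _ _ (@bern_pgf R))//= coef_below_bernM2.
  have Ev : coef_below k.+2 (pbin_pgf v) =
      coef_below k.+2 p - (v i + v j) * p`_k.+1 + v i * v j * D.
    by rewrite -E update2_id.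
  have S (F : R -> R) c d : \sum_l F (update2 v i j c d l) =
      F c + (F d + \sum_(l < n | (l != i) && (l != j)) F (v l)).
    exact: (big_update2 _ _ _ _ _ _ F).
  have Sv (F : R -> R) : \sum_l F (v l) =
      F (v i) + (F (v j) + \sum_(l < n | (l != i) && (l != j)) F (v l)).
    by rewrite -S update2_id.
  have [||le_f le_sq] := vmin (update2 v i j a b).
  - by move=> l; rewrite /update2; case: eqP => // _; case: eqP.
  - by rewrite -vq (S id) (Sv id) /= !addrA abE.
  split; first by move: le_f; rewrite E Ev abE lerD2l.
  move=> le_ab; move: le_sq; rewrite E Ev abE lerD2l => /(_ le_ab).
  by rewrite (S (fun x => x ^+ 2)) (Sv (fun x => x ^+ 2)) !addrA lerD2r.
have [/andP[vi0 vi1] /andP[vj0 vj1]] := (v01 i, v01 j).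
(* If [D <= 0], replacing both entries by their midpoint raises their product, hence does not raise
   the probability, and strictly lowers the sum of squares: this contradicts the tie-break. *)
have D0 : 0 < D.
  rewrite ltNge; apply/negP => D0.
  have [|||_ hmin] := min2 ((v i + v j) / 2) ((v i + v j) / 2).
  - by apply/andP; split; lra.
  - by apply/andP; split; lra.
  - by field.
  have : (v i + v j) / 2 * ((v i + v j) / 2) * D <= v i * v j * D.
    apply: ler_wnM2r => //; rewrite -subr_ge0.
    rewrite (_ : _ - _ = ((v j - v i) / 2) ^+ 2) ?sqr_ge0//; by field.
  move=> /hmin; rewrite leNgt => /negP; apply; rewrite -subr_gt0.
  rewrite (_ : _ - _ = (v j - v i) ^+ 2 / 2); last by field.
  by rewrite divr_gt0// exprn_gt0// subr_gt0.
split; last by rewrite -subr_gt0.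
have [vi_eq0|vi_neq0] := eqVneq (v i) 0; first by left.
have [vj_eq1|vj_neq1] := eqVneq (v j) 1; first by right.
have vi_gt0 : 0 < v i by rewrite lt_neqAle eq_sym vi_neq0.
have vj_lt1 : v j < 1 by rewrite lt_neqAle vj_neq1.
(* With [D > 0], spreading the entries apart strictly lowers their product and so the probability;
   [t] is the largest shift that stays in [0, 1]. *)
pose t := Num.min (v i) (1 - v j).
have t0 : 0 < t by rewrite lt_min vi_gt0 subr_gt0.
have [ti tj] : t <= v i /\ t <= 1 - v j by rewrite !ge_min !lexx orbT.
have [|||] := min2 (v i - t) (v j + t).
- by apply/andP; split; lra.
- by apply/andP; split; lra.
- by ring.
rewrite ler_pM2r// => + _; rewrite leNgt => /negP[].
rewrite -subr_gt0 (_ : _ - _ = t * (v j - v i + t)); last by ring.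
by rewrite mulr_gt0// addr_gt0// subr_gt0.
Qed.

Lemma pbin_pgf_cst (R : realType) n (a : R) :
  pbin_pgf (fun _ : 'I_n => a) = bern_pgf a ^+ n :> {poly R}.
Proof. by rewrite /pbin_pgf prodr_const card_ord. Qed.

(** Zeros contribute the factor 1 and ones the factor ['X], which leaves a shifted binomial: [s]
    counts the entries treated as 1 and [N] those treated as [a]. *)
Lemma three_valued_pgf (R : realType) n (v : 'I_n -> R) (P : pred 'I_n) a :
  (forall l, [\/ v l = 0, v l = 1 | v l = a]) ->
  exists s N, \prod_(l | P l) bern_pgf (v l) = 'X^s * bern_pgf a ^+ N /\
    \sum_(l | P l) v l = s%:R + N%:R * a.
Proof.
move=> v3; elim: (index_enum _) => [|l r [s [N [IHp IHs]]]].
  by exists 0%N, 0%N; rewrite !big_nil expr0 mulr1 mul0r addr0.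
rewrite !big_cons; case: (P l); last by exists s, N.
rewrite IHp IHs; case: (v3 l) => ->.
- by exists s, N; rewrite /bern_pgf scale0r subr0 addr0 mul1r add0r.
- exists s.+1, N; rewrite {1}/bern_pgf subrr add0r scale1r exprS mulrA; split=> //.
  by rewrite -[s.+1%:R]natr1; ring.
- exists s, N.+1; rewrite exprS mulrCA; split=> //.
  by rewrite -[N.+1%:R]natr1; ring.
Qed.

(** A constant extremal vector is the binomial case itself. Two unequal entries would force a strict
    increase between two consecutive weights of the other trials, a shifted binomial already beyond
    its mode. *)
Lemma hoeffding_binom_lt (R : realType) n k (q : 'I_n -> R) : (0 < n)%N ->
  unit_box q -> \sum_i q i <= k%:R ->
  binom_lt k.+1 n ((\sum_i q i) / n%:R) <= coef_below k.+1 (pbin_pgf q).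
Proof.
move=> n0 q01 qk.
have [v [v01 vq vle vmin]] := exists_extremal _ _ k.+1 _ q01.
have [vcst|] := pselect (forall i j, v i = v j).
  suff -> : binom_lt k.+1 n ((\sum_i q i) / n%:R) = coef_below k.+1 (pbin_pgf v) by [].
  have vE : v = fun=> v (Ordinal n0) by apply/funext => i; exact: vcst.
  rewrite -vq vE sumr_const card_ord pbin_pgf_cst -[_ *+ n in LHS]mulr_natr mulfK//.
  by rewrite pnatr_eq0 -lt0n.
move=> /existsNP[i0 /existsNP[j0 vij0]]; exfalso.
have {i0 j0 vij0} [i [j vij]] : exists i j, v i < v j.
  have [ij|ij|//] := ltgtP (v i0) (v j0); first by exists i0, j0.
  by exists j0, i0.
have v0 l : 0 <= v l by have /andP[] := v01 l.
have v_gt0 : 0 < v j by apply: le_lt_trans vij.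
have v_le : v j <= k%:R.
  by rewrite (le_trans _ qk)// -vq (bigD1 j)//= lerDl sumr_ge0.
(* For k = 0 every entry would vanish, against [0 < v j]; for larger k the threshold has the form
   required by [extremal_pair]. *)
case: k qk vle vmin v_le => [|k] qk vle vmin v_le.
  by move: v_gt0; rewrite ltNge v_le.
have two a b := extremal_pair R n k q v a b v01 vq vmin.
pose inner := fun l => (0 < v l) && (v l < 1).
have inner_eq l m : inner l -> inner m -> v l = v m.
  move=> /andP[l0 l1] /andP[m0 m1].
  have [lm|lm|//] := ltgtP (v l) (v m).
    by have [[E|E] _] := two _ _ lm; [move: l0|move: m1]; rewrite E ltxx.
  by have [[E|E] _] := two _ _ lm; [move: m0|move: l1]; rewrite E ltxx.
have v3 l : [\/ v l = 0, v l = 1 | inner l].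
  have /andP[l0 l1] := v01 l.
  move: l0; rewrite le_eqVlt => /predU1P[<-|l0]; first exact: Or31.
  move: l1; rewrite le_eqVlt => /predU1P[->|l1]; first exact: Or32.
  by apply: Or33; rewrite /inner l0.
(* If no entry lies strictly between 0 and 1, then a = 0 serves. *)
have [a [a01 av aj]] : exists a, [/\ 0 <= a <= 1,
    forall l, [\/ v l = 0, v l = 1 | v l = a] & a <= v j].
  have [[m inm]|noinner] := pselect (exists m, inner m).
    exists (v m); split => // [l|].
      by case: (v3 l) => [?|?|inl]; [exact: Or31|exact: Or32|apply/Or33/inner_eq].
    case: (v3 j) => [E|->|inj]; last by rewrite (inner_eq j m).
      by move: v_gt0; rewrite E ltxx.
    by have /andP[] := v01 m.
  exists 0; split; rewrite ?lexx ?ler01 ?ltW// => l.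
  by case: (v3 l) => [?|?|inl]; [exact: Or31|exact: Or32|case: noinner; exists l].
have [_] := two _ _ vij.
have [s [N [-> sE]]] := three_valued_pgf _ _ _ (fun l => (l != i) && (l != j)) _ av.
have ij : i != j by apply/eqP => ij; move: vij; rewrite ij ltxx.
have vS : \sum_l q l = v i + (v j + (s%:R + N%:R * a)).
  by rewrite -vq (bigD1 i)//= (bigD1 j) 1?eq_sym//= sE.
have /andP[a0 _] := a01.
have Na0 : 0 <= N%:R * a by rewrite mulr_ge0.
have vi0 := v0 i.
(* As [v j] is positive the sum exceeds s, so the shift by ['X^s] leaves both compared coefficients
   at genuine indices. *)
have sk : (s <= k)%N.
  rewrite -ltnS -(ltr_nat R); apply: lt_le_trans qk; rewrite vS; lra.
rewrite !coefXnM !ltnNge sk (leq_trans sk (leqnSn k)) /= subSn//.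
rewrite ltNge => /negP; apply; apply: coef_bern_pgfX_nincr => //.
(* The mean bound gives v_j + N a <= k + 1 - s, and [a <= v j] turns it into (N + 1) a <= k + 1 -
   s. *)
rewrite -subSn// natrB ?(leq_trans sk (leqnSn k))//.
move: qk; rewrite vS -[N.+1%:R]natr1; lra.
Qed.

Lemma coef_pbin_ge0 (R : realType) n (q : 'I_n -> R) j : unit_box q ->
  0 <= (pbin_pgf q)`_j.
Proof.
move=> q01; rewrite /pbin_pgf; elim: (index_enum _) j => [|i s IH] j.
  by rewrite big_nil coef1 ler0n.
have /andP[? ?] := q01 i.
rewrite big_cons coef_bern_pgfM addr_ge0// mulr_ge0 ?subr_ge0//.
by case: j.
Qed.

(** * Interpolation between consecutive integer means *)

Lemma affine_ge0 (R : realType) (u v a b x : R) : a <= x <= b ->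
  0 <= u + a * v -> 0 <= u + b * v -> 0 <= u + x * v.
Proof.
move=> /andP[ax xb] ha hb; have [v0|v0] := leP 0 v.
  by apply: le_trans ha _; rewrite lerD2l ler_wpM2r.
by apply: le_trans hb _; rewrite lerD2l ler_wnM2r// ltW.
Qed.

(** Induction on the number of entries strictly between 0 and 1: sliding one of them to an end of
    its allowed range either lowers this number or makes the sum k or k + 1, which [base]
    settles. *)
Lemma interpolated_binom_lt (R : realType) n k (q : 'I_n -> R) : (0 < n)%N ->
  unit_box q -> k%:R <= \sum_i q i <= k.+1%:R ->
  (k.+1%:R - \sum_i q i) * binom_lt k.+1 n (k%:R / n%:R) <=
  coef_below k.+1 (pbin_pgf q).
Proof.
move=> n0.
have [m] := ubnP #|[pred i | (0 < q i) && (q i < 1)]|.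
elim: m q => // m IH q cardq q01 kq; set b := binom_lt _ _ _.
have base (w : 'I_n -> R) : unit_box w ->
    \sum_i w i = k%:R \/ \sum_i w i = k.+1%:R ->
    (k.+1%:R - \sum_i w i) * b <= coef_below k.+1 (pbin_pgf w).
  move=> w01 [wk|->].
    rewrite wk -natr1 addrC addKr mul1r /b -wk; apply: hoeffding_binom_lt => //.
    by rewrite wk.
  by rewrite subrr mul0r sumr_ge0// => j _; exact: coef_pbin_ge0.
have [qk|qk] := eqVneq (\sum_i q i) k%:R; first by apply: base => //; left.
have [qk1|qk1] := eqVneq (\sum_i q i) k.+1%:R; first by apply: base => //; right.
have {qk qk1} /andP[kq0 kq1] : k%:R < \sum_i q i < k.+1%:R.
  by have /andP[? ?] := kq; rewrite !lt_neqAle eq_sym qk qk1; apply/andP.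
(* Without a fractional entry the sum would be an integer strictly between k and k + 1. *)
have [i /andP[qi0 qi1]] : exists i, (0 < q i) && (q i < 1).
  apply: contrapT => noi.
  have q3 l : [\/ q l = 0, q l = 1 | q l = 0].
    have /andP[l0 l1] := q01 l.
    move: l0; rewrite le_eqVlt => /predU1P[<-|l0]; first exact: Or31.
    move: l1; rewrite le_eqVlt => /predU1P[->|l1]; first exact: Or32.
    by case: noi; exists l; rewrite l0.
  have [s [N [_]]] := three_valued_pgf _ _ _ xpredT _ q3.
  rewrite mulr0 addr0 => sE; move: kq0 kq1; rewrite sE !ltr_nat ltnS => /leq_trans h.
  by move=> /h; rewrite ltnn.
pose w x := fun l => if l == i then x else q l.
pose c := \sum_(l < n | l != i) q l.
pose p := \prod_(l < n | l != i) bern_pgf (q l).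
have wS x : \sum_l w x l = x + c.
  rewrite (bigD1 i)//= /w eqxx; congr (_ + _).
  by apply: eq_bigr => l /negbTE->.
have wP x : pbin_pgf (w x) = bern_pgf x * p.
  rewrite /pbin_pgf (bigD1 i)//= /w eqxx; congr (_ * _).
  by apply: eq_bigr => l /negbTE->.
have wq : w (q i) = q by apply/funext => l; rewrite /w; case: eqP => [->|].
have qS : \sum_l q l = q i + c by rewrite -wS wq.
have endpoint x : 0 <= x <= 1 -> k%:R <= x + c <= k.+1%:R ->
    [\/ x = 0, x = 1, x + c = k%:R | x + c = k.+1%:R] ->
    0 <= coef_below k.+1 (pbin_pgf (w x)) - (k.+1%:R - (x + c)) * b.
  move=> x01 xc xcases; rewrite subr_ge0 -wS.
  have w01 : unit_box (w x) by move=> l; rewrite /w; case: eqP.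
  have IHx : x = 0 \/ x = 1 ->
      (k.+1%:R - \sum_l w x l) * b <= coef_below k.+1 (pbin_pgf (w x)).
    move=> x2; apply: IH => //; last by rewrite wS.
    rewrite -ltnS; apply: leq_trans cardq; rewrite ltnS.
    apply/proper_card/properP; split.
      apply/fintype.subsetP => l; rewrite !inE /w; case: (eqVneq l i) => // -> _.
      by rewrite qi0.
    exists i; rewrite !inE ?qi0// /w eqxx.
    by case: x2 => ->; rewrite ltxx ?andbF.
  case: xcases => E; [apply: IHx; by left|apply: IHx; by right| |].
  - by apply: base => //; left; rewrite wS.
  - by apply: base => //; right; rewrite wS.
(* Conditioning on trial i makes the difference of the two sides the affine function u + x v of its
   entry x. *)
pose u := coef_below k.+1 p - (k.+1%:R - c) * b.
pose v := b + coef_below k p - coef_below k.+1 p.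
have E x : coef_below k.+1 (pbin_pgf (w x)) - (k.+1%:R - (x + c)) * b = u + x * v.
  by rewrite wP coef_below_bernM /u /v/=; ring.
have h0 : k%:R < q i + c by rewrite -qS.
have h1 : q i + c < k%:R + 1 by rewrite natr1 -qS.
rewrite -subr_ge0 qS -[X in pbin_pgf X]wq E.
(* The range keeps x in [0, 1] and the sum in [k, k + 1]; each end falls under one of the four cases
   of [endpoint]. *)
apply: (@affine_ge0 _ _ _ (Num.max 0 (k%:R - c)) (Num.min 1 (k.+1%:R - c))).
- rewrite ge_max le_min.
  by rewrite -natr1; apply/andP; split; apply/andP; split; lra.
- rewrite -E.
  case: (leP 0 (k%:R - c)) => h; apply: endpoint; rewrite -?natr1.
  + by apply/andP; split; lra.
  + by apply/andP; split; lra.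
  + by apply: Or43; lra.
  + by rewrite lexx ler01.
  + by apply/andP; split; lra.
  + exact: Or41.
- rewrite -E.
  case: (leP 1 (k.+1%:R - c)) => h; apply: endpoint; rewrite -?natr1 in h *.
  + by rewrite lexx ler01.
  + by apply/andP; split; lra.
  + exact: Or42.
  + by apply/andP; split; lra.
  + by apply/andP; split; lra.
  + by apply: Or44; lra.
Qed.

(** * Binomial tails at the mean when the sample is enlarged *)

Lemma binom_lt_addn (R : realType) k n : (0 < n)%N -> (k <= n)%N ->
  binom_lt k.+1 n.+1 (k%:R / n.+1%:R : R) <= binom_lt k.+1 n (k%:R / n%:R : R).
Proof.
move=> n0 kn; have n_gt0 : 0 < n%:R :> R by rewrite ltr0n.
(* A sure failure is adjoined: neither the count nor the total mean k changes. *)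
pose q := fun l : 'I_n.+1 => if l == ord0 then 0 : R else k%:R / n%:R.
have qS : \sum_l q l = k%:R.
  rewrite big_ord_recl /q eqxx add0r sumr_const card_ord.
  by rewrite -[_ *+ n]mulr_natr divfK// gt_eqF.
have qP : pbin_pgf q = bern_pgf (k%:R / n%:R) ^+ n.
  rewrite /pbin_pgf big_ord_recl /q eqxx /= prodr_const card_ord.
  by rewrite {1}/bern_pgf scale0r subr0 addr0 mul1r.
have := hoeffding_binom_lt R n.+1 k q isT; rewrite qS qP; apply => // l.
rewrite /q; case: eqP => _; first by rewrite lexx ler01.
by rewrite divr_ge0 ?ler0n//= ler_pdivrMr// mul1r ler_nat.
Qed.

Lemma binom_lt_addSn (R : realType) k n : (0 < n)%N -> (k <= n)%N ->
  binom_lt k.+2 n.+1 (k.+1%:R / n.+1%:R : R) <= binom_lt k.+1 n (k%:R / n%:R : R).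
Proof.
move=> n0 kn; have n_gt0 : 0 < n%:R :> R by rewrite ltr0n.
(* A sure success is adjoined: count, threshold and total mean all grow by one. *)
pose q := fun l : 'I_n.+1 => if l == ord0 then 1 : R else k%:R / n%:R.
have qS : \sum_l q l = k.+1%:R.
  rewrite big_ord_recl /q eqxx sumr_const card_ord.
  by rewrite -[_ *+ n]mulr_natr divfK ?gt_eqF// -natr1 addrC.
have qP : pbin_pgf q = bern_pgf 1 * bern_pgf (k%:R / n%:R) ^+ n.
  by rewrite /pbin_pgf big_ord_recl /q eqxx /= prodr_const card_ord.
have := hoeffding_binom_lt R n.+1 k.+1 q isT; rewrite qS qP coef_below_bernM.
rewrite subrr mul0r add0r mul1r; apply => // l.
rewrite /q; case: eqP => _; first by rewrite lexx ler01.
by rewrite divr_ge0 ?ler0n//= ler_pdivrMr// mul1r ler_nat.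
Qed.

(** Lowering first n, then k and n together, leads down to k = 1 and n = 2, where P(Bin(2, 1/2) <=
    1) = 3/4. *)
Lemma binom_lt_mean_le (R : realType) k n : (0 < k < n)%N ->
  binom_lt k.+1 n (k%:R / n%:R : R) <= 3 / 4.
Proof.
case: k => // k /= kn.
have [d ->] : exists d, n = (d + k.+2)%N by exists (n - k.+2)%N; rewrite subnK.
elim: d => [|d IH]; last first.
  by apply: le_trans IH; rewrite addSn; apply: binom_lt_addn;
    rewrite addnS// leqW// leq_addl.
rewrite add0n; elim: k {kn} => [|k IH]; last first.
  by apply: le_trans IH; exact: binom_lt_addSn.
rewrite /binom_lt !exprS expr0 !coef_below_bernM /=.
rewrite !coef_belowS !coef_below0 !coef1 /=; lra.
Qed.

(** * The law of the number of successes *)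

Definition pattern_prob {R : realType} {n} (q : 'I_n -> R) (f : {ffun 'I_n -> bool}) : R :=
  \prod_(i < n) (if f i then q i else 1 - q i).

(** Distributing the product over the sums yields one monomial for each outcome pattern, whose
    degree is the number of successes. *)
Lemma coef_below_pbin (R : realType) n k (q : 'I_n -> R) :
  coef_below k (pbin_pgf q) =
  \sum_(f : {ffun 'I_n -> bool} | (\sum_i f i < k)%N) pattern_prob q f.
Proof.
have -> : pbin_pgf q = \sum_(f : {ffun 'I_n -> bool}) pattern_prob q f *: 'X^(\sum_i f i).
  transitivity (\prod_i \sum_(b : bool) ((if b then q i else 1 - q i) *: 'X^b : {poly R})).
    apply: eq_bigr => i _; rewrite big_bool /bern_pgf /= expr0 expr1.
    by rewrite alg_polyC addrC.
  rewrite bigA_distr_bigA; apply: eq_bigr => f _.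
  by rewrite scaler_prod prodrXr.
rewrite /coef_below.
under eq_bigr do rewrite coef_sum.
rewrite exchange_big [RHS]big_mkcond; apply: eq_bigr => f _ /=.
under eq_bigr do rewrite coefZ coefXn.
case: ltnP => fk.
  rewrite (bigD1 (Ordinal fk))//= eqxx mulr1 big1 ?addr0// => i ik.
  rewrite (_ : (i == _ :> nat) = false) ?mulr0//.
  by apply: contra_neqF ik => /eqP ik; exact: val_inj.
by rewrite big1// => i _; rewrite ltn_eqF ?mulr0// (leq_trans _ fk).
Qed.

(** Phrased as an intersection over the full index set, so that [mutually_independent] applies as it
    stands. *)
Definition pattern {R : realType} {disp} {Omega : measurableType disp}
    {P : probability Omega R} {n} (T : 'I_n -> {RV P >-> bool})
    (f : {ffun 'I_n -> bool}) : set Omega :=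
  \bigcap_(i in [set` [set: 'I_n]%SET]) (T i @^-1` [set f i]).

Lemma patternE (R : realType) disp (Omega : measurableType disp)
    (P : probability Omega R) n (T : 'I_n -> {RV P >-> bool}) f w :
  pattern T f w <-> f = [ffun i => T i w].
Proof.
split=> [fw|-> i _ /=]; last by rewrite ffunE.
by apply/ffunP => i; rewrite ffunE; apply/esym/fw; rewrite /= finset.in_setT.
Qed.

Lemma measurable_pattern (R : realType) disp (Omega : measurableType disp)
    (P : probability Omega R) n (T : 'I_n -> {RV P >-> bool}) f :
  measurable (pattern T f).
Proof.
rewrite /pattern; apply: fin_bigcap_measurable => [|i _].
  exact: finite_finset.
exact: measurable_funPTI.
Qed.

Lemma prob_pattern (R : realType) disp (Omega : measurableType disp)
    (P : probability Omega R) n (T : 'I_n -> {RV P >-> bool}) (q : 'I_n -> R) f :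
  (forall i, P [set w | T i w = true] = (q i)%:E) -> mutually_independent T ->
  P (pattern T f) = (pattern_prob q f)%:E.
Proof.
move=> hT hind; rewrite /pattern hind//.
under eq_bigl do rewrite finset.inE.
rewrite /pattern_prob -prodEFin; apply: eq_bigr => i _.
case: (f i); first exact: hT.
rewrite (_ : _ @^-1` _ = ~` [set w | T i w = true]).
  by rewrite probability_setC ?hT//; exact: (@measurable_funPTI _ _ _ _ (T i) [set true]).
by apply/seteqP; split => w /=; case: (T i w).
Qed.

(** Decomposing into patterns gives both measurability and probability; a general [Q] serves counts
    of successes and of failures alike. *)
Lemma successes_bigcup (R : realType) disp (Omega : measurableType disp)
    (P : probability Omega R) n (T : 'I_n -> {RV P >-> bool}) (Q : pred nat) :
  [set w | Q (successes T w)] =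
  \bigcup_(f in [set` enum [pred f : {ffun 'I_n -> bool} | Q (\sum_i f i)%N]]) pattern T f.
Proof.
have E w : successes T w = (\sum_i [ffun i => T i w] i)%N.
  by rewrite /successes; apply: eq_bigr => i _; rewrite ffunE.
apply/seteqP; split => [w /= Qw|w [f /=]].
  exists [ffun i => T i w]; last exact/patternE.
  by rewrite /= mem_enum inE -E.
by rewrite mem_enum inE => Qf /patternE fE; rewrite E -fE.
Qed.

Lemma measurable_successes (R : realType) disp (Omega : measurableType disp)
    (P : probability Omega R) n (T : 'I_n -> {RV P >-> bool}) (Q : pred nat) :
  measurable [set w | Q (successes T w)].
Proof.
rewrite successes_bigcup; apply: fin_bigcup_measurable => // f _.
exact: measurable_pattern.
Qed.

Lemma prob_successes (R : realType) disp (Omega : measurableType disp)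
    (P : probability Omega R) n (T : 'I_n -> {RV P >-> bool}) (q : 'I_n -> R)
    (Q : pred nat) :
  (forall i, P [set w | T i w = true] = (q i)%:E) -> mutually_independent T ->
  P [set w | Q (successes T w)] =
  (\sum_(f : {ffun 'I_n -> bool} | Q (\sum_i f i)%N) pattern_prob q f)%:E.
Proof.
move=> hT hind; rewrite successes_bigcup measure_fin_bigcup//.
- rewrite -fsbig_seq ?enum_uniq// big_enum -sumEFin/=.
  by apply: eq_bigr => f _; rewrite (prob_pattern _ _ _ _ _ _ q).
- by apply/trivIsetP => f g _ _ fg; apply/seteqP; split => // w [/patternE fE /patternE gE];
    move: fg; rewrite fE gE eqxx.
- by move=> f _; exact: measurable_pattern.
Qed.

Lemma prob_successes_lt (R : realType) disp (Omega : measurableType disp)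
    (P : probability Omega R) n (T : 'I_n -> {RV P >-> bool}) (q : 'I_n -> R) k :
  (forall i, P [set w | T i w = true] = (q i)%:E) -> mutually_independent T ->
  P [set w | (successes T w < k)%N] = (coef_below k (pbin_pgf q))%:E.
Proof.
move=> hT hind.
by rewrite (prob_successes _ _ _ _ _ _ q (fun m => m < k)%N)// coef_below_pbin.
Qed.

(** Flipping every outcome is an involution on patterns that exchanges q_i and 1 - q_i. *)
Lemma prob_failures_lt (R : realType) disp (Omega : measurableType disp)
    (P : probability Omega R) n (T : 'I_n -> {RV P >-> bool}) (q : 'I_n -> R) k :
  (forall i, P [set w | T i w = true] = (q i)%:E) -> mutually_independent T ->
  P [set w | (n - successes T w < k)%N] =
  (coef_below k (pbin_pgf (fun i => 1 - q i)))%:E.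
Proof.
move=> hT hind.
rewrite (prob_successes _ _ _ _ _ _ q (fun m => n - m < k)%N)// coef_below_pbin.
congr EFin; pose neg := fun f : {ffun 'I_n -> bool} => [ffun i => ~~ f i].
have negK : involutive neg by move=> f; apply/ffunP => i; rewrite !ffunE negbK.
rewrite [RHS](reindex_inj (inv_inj negK)); apply: eq_big => f.
  have nE : (\sum_i f i + \sum_i neg f i = n)%N.
    rewrite -big_split/= -[RHS]card_ord -sum1_card; apply: eq_bigr => i _.
    by rewrite ffunE; case: (f i).
  by rewrite -{1}nE addKn.
move=> _; apply: eq_bigr => i _; rewrite ffunE.
by case: (f i); rewrite //= subKr.
Qed.

(** * The two statistics *)

Lemma alpha_starE (R : realType) k n : (k <= n)%N ->
  alpha_star k.+1 n.+1 = 1 - binom_lt k.+1 n.+1 (k%:R / n.+1%:R) :> R.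
Proof.
move=> kn; rewrite /alpha_star.
have -> : n.+1%:R - k.+1%:R + 1 = (n - k).+1%:R :> R.
  by rewrite -[k.+1%:R]natr1 -[(n - k).+1%:R]natr1 natrB// -[n.+1%:R]natr1; ring.
rewrite -{1}[k.+1%:R]natr1 addrK inc_beta_nat// divr_ge0//=.
by rewrite ler_pdivrMr// mul1r ler_nat ltnW.
Qed.

Lemma alpha_daggerE (R : realType) k n : alpha_dagger k n = alpha_star k.+1 n :> R.
Proof.
by rewrite /alpha_dagger /alpha_star -natr1 addrK; congr inc_beta; ring.
Qed.

(** Strict monotonicity, since k/(n + 1) < 1 and the tail vanishes at 1. This keeps the denominator
    in [qhat_g] positive. *)
Lemma alpha_star_lt1 (R : realType) k n : (k <= n)%N -> alpha_star k.+1 n.+1 < 1 :> R.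
Proof.
move=> kn; rewrite alpha_starE// gtrDl oppr_lt0 -(binom_lt_1 R k.+1 n.+1)//.
apply: binom_lt_decr => //; rewrite ?divr_ge0//.
by rewrite ltr_pdivrMr// mul1r ltr_nat.
Qed.

Lemma alpha_star_ge14 (R : realType) k n : (k.+1 < n)%N ->
  1 / 4 <= alpha_star k.+2 n :> R.
Proof.
case: n => // n kn; rewrite alpha_starE//.
by have := binom_lt_mean_le R k.+1 n.+1 kn; lra.
Qed.

Lemma inc_beta_inv_binom_lt (R : realType) (alpha : R) k n : (k <= n)%N ->
  0 <= alpha <= 1 ->
  let x := inc_beta_inv alpha k.+1%:R (n.+1%:R - k.+1%:R + 1) in
  0 <= x <= 1 /\ binom_lt k.+1 n.+1 x = 1 - alpha.
Proof.
move=> kn a01 x.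
have := inc_beta_invP R k n alpha kn a01.
have <- : n.+1%:R - k.+1%:R + 1 = (n - k).+1%:R :> R.
  by rewrite -[k.+1%:R]natr1 -[(n - k).+1%:R]natr1 natrB// -[n.+1%:R]natr1; ring.
by move=> [? E]; split=> //; rewrite -[in RHS]E subKr.
Qed.

(** On the affine branch the hypothesis rearranges to 1 - alpha < (k + 1 - sum) b for positive index
    k + 1, the form of the interpolated bound. On the other branch Hoeffding's inequality and
    monotonicity of the tail suffice. *)
Lemma qhat_g_coef_below (R : realType) n k (q : 'I_n -> R) (alpha : R) :
  unit_box q -> 0 <= alpha <= 1 -> (k <= n)%N ->
  (\sum_i q i) / n%:R < qhat_g alpha k n ->
  1 - alpha <= coef_below k (pbin_pgf q).
Proof.
move=> q01 a01 kn; have /andP[a0 a1] := a01; rewrite /qhat_g.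
have q0 : 0 <= \sum_i q i by apply: sumr_ge0 => i _; have /andP[] := q01 i.
(* At k = 0 the statistic is 0, which the mean cannot undercut. *)
case: k kn => [_|k kn /=]; first by rewrite eqxx ltNge divr_ge0.
case: n q q01 q0 kn => // n q q01 q0 kn; rewrite ltnS in kn.
have n0 : 0 < n.+1%:R :> R by rewrite ltr0n.
set b := binom_lt k.+1 n.+1 (k%:R / n.+1%:R : R).
have aE : alpha_star k.+1 n.+1 = 1 - b by exact: alpha_starE.
have b0 : 0 < b by have := alpha_star_lt1 R k n kn; rewrite aE gtrDl oppr_lt0.
rewrite aE subKr.
have kn1 : k%:R / n.+1%:R <= 1 :> R by rewrite ler_pdivrMr// mul1r ler_nat ltnW.
have k0 : 0 <= k%:R / n.+1%:R :> R by rewrite divr_ge0.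
have qn0 : 0 <= (\sum_i q i) / n.+1%:R by rewrite divr_ge0.
case: ifPn => [ab qlt|].
  have : (1 - alpha) / b < k.+1%:R - \sum_i q i.
    move: qlt; rewrite -(ltr_pM2r n0) mulrBl !divfK ?gt_eqF// invfM mulrA mulrAC.
    by rewrite mulrAC (mulrAC _ _ b^-1) divfK ?gt_eqF//; lra.
  rewrite ltr_pdivrMr// => h.
  have [kq|qk] := leP k%:R (\sum_i q i).
    apply: le_trans (ltW h) _; apply: interpolated_binom_lt => //; rewrite kq /=.
    (* The sum is at most k + 1 because (k + 1 - sum) b exceeds 1 - alpha >= 0. *)
    rewrite -subr_ge0 -(pmulr_lge0 _ b0); apply: le_trans (ltW h).
    by rewrite subr_ge0.
  apply: le_trans (hoeffding_binom_lt _ _ _ _ _ q01 (ltW qk)) => //.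
  apply: (@le_trans _ _ b); first lra.
  by apply: binom_lt_anti => //; rewrite ler_pM2r ?invr_gt0// ltW.
rewrite -ltNge => ab qlt.
have [/andP[x0 x1] xE] := inc_beta_inv_binom_lt R alpha k n kn a01.
set x := inc_beta_inv _ _ _ in qlt x0 x1 xE.
(* Otherwise the tail 1 - alpha at x would be at most b, against the branch condition; so the sum is
   below k and Hoeffding's inequality applies. *)
have xk : x < k%:R / n.+1%:R.
  rewrite ltNge; apply/negP => kx.
  by have := binom_lt_anti R k n _ _ kn k0 kx x1; rewrite -/b xE; lra.
rewrite -xE; apply: le_trans (hoeffding_binom_lt _ _ _ _ _ q01 _) => //.
  by apply: binom_lt_anti => //; exact: ltW.
by rewrite -(ler_pM2r (x := n.+1%:R^-1)) ?invr_gt0// ltW// (lt_trans qlt).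
Qed.

(** With k the least index at which [h] exceeds [x], the event [N w < k] lies inside the coverage
    event; if there is no such index, coverage is certain. *)
Lemma minimal_index_coverage (R : realType) disp (Omega : measurableType disp)
    (P : probability Omega R) n (N : Omega -> nat) (h : nat -> R) (x c : R) :
  (forall w, N w <= n)%N ->
  (forall Q : pred nat, measurable [set w | Q (N w)]) ->
  c <= 1 ->
  (forall k, (k <= n)%N -> x < h k -> (c%:E <= P [set w | (N w < k)%N])%E) ->
  (c%:E <= P [set w | (h (N w) <= x)%R])%E.
Proof.
move=> Nn mN c1 hc.
have [ex|noex] := pselect (exists k, (k <= n)%N && (x < h k)).
  case: (ex_minnP ex) => k /andP[kn xk] kmin.
  apply: (le_trans (hc k kn xk)); apply: le_measure; rewrite ?inE.
  - exact: (mN (fun m => m < k)%N).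
  - exact: (mN (fun m => h m <= x)).
  - move=> w /= Nk; rewrite leNgt; apply/negP => xN.
    by have := kmin (N w); rewrite Nn xN => /(_ isT); rewrite leqNgt Nk.
rewrite (_ : [set _ | _] = setT) ?probability_setT ?lee_fin//.
apply/seteqP; split=> // w _ /=; rewrite leNgt; apply/negP => xN.
by apply: noex; exists (N w); rewrite Nn.
Qed.

(** * Agreement of the two statistics *)

Lemma bernoulli_ineq (R : realDomainType) (x : R) n : 0 <= x ->
  n.+1%:R * x <= n%:R + x ^+ n.+1.
Proof.
move=> x0; elim: n => [|n IH]; first by rewrite mul1r expr1 add0r.
have h : x * (n.+1%:R * x) <= x * (n%:R + x ^+ n.+1) by exact: ler_wpM2l.
rewrite exprS -lerBlDl; apply: (@le_trans _ _ (x * (n.+1%:R * x) - x * n%:R)); last lra.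
rewrite -subr_ge0 -[n.+2%:R]natr1 -[n.+1%:R]natr1.
rewrite (_ : _ - _ = (n%:R + 1) * (x - 1) ^+ 2); last by ring.
by rewrite mulr_ge0 ?sqr_ge0// addr_ge0.
Qed.

Lemma binom_lt_gt (R : realType) k n (x : R) : (n < k)%N -> binom_lt k n x = 1.
Proof.
rewrite /binom_lt; elim: n k => [|n IH] [|k]// nk; first by rewrite expr0 coef_below1.
by rewrite exprS coef_below_bernM /= !IH ?(ltnW nk)// !mulr1 subrK.
Qed.

(** The second Beta parameter is 1, so the inverse x in term s solves x^(n-s+1) = 1 - alpha.
    Bernoulli's inequality bounds every term by the value at s = n. *)
Lemma Smax_pred (R : realType) n (alpha : R) : 0 <= alpha <= 1 ->
  Smax n.+1 n alpha = 1 - alpha / n.+1%:R.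
Proof.
move=> a01; have /andP[a0 a1] := a01.
have n0 : 0 < n.+1%:R :> R by rewrite ltr0n.
have S_le s : (s <= n)%N -> Sterm n.+1 n alpha s <= 1 - alpha / n.+1%:R /\
    (s = n -> Sterm n.+1 n alpha s = 1 - alpha / n.+1%:R).
  move=> sn; rewrite /Sterm.
  have ca01 : 0 <= 1 - alpha <= 1 by apply/andP; split; lra.
  have [/andP[]] := inc_beta_invP R (n - s) (n - s) (1 - alpha) (leqnn _) ca01.
  have -> : n.+1%:R - n%:R = (n - s - (n - s)).+1%:R :> R.
    by rewrite subnn -natr1 addrC addKr.
  have -> : n%:R - s%:R + 1 = (n - s).+1%:R :> R by rewrite -natr1 natrB.
  set x := inc_beta_inv _ _ _ => x0 x1 xE.
  have {}xE : x ^+ (n - s).+1 = 1 - alpha.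
    rewrite -[RHS]xE.
    (* The total mass 1 is written as the sum of all coefficients, so that only the top one remains
       after subtraction. *)
    rewrite -(binom_lt_gt R (n - s).+2 (n - s).+1 x (leqnn _)) /binom_lt.
    by rewrite coef_belowS addrC addKr coef_bern_pgfX// binn mul1r subnn expr0 mulr1.
  have nsE : n.+1%:R = s%:R + (n - s).+1%:R :> R by rewrite -natrD addnS subnKC.
  have -> : n.+1%:R - s%:R = (n - s).+1%:R :> R by rewrite nsE addrC addKr.
  split=> [|sE].
    rewrite ler_pdivrMr// mulrBl divfK ?gt_eqF// mul1r nsE.
    have := bernoulli_ineq _ x (n - s) x0; rewrite xE -natr1; lra.
  move: xE; rewrite sE subnn expr1 mul1r => ->; field; by rewrite gt_eqF.
apply/le_anti/andP; split.
  rewrite /Smax big_mkord; apply: bigmax_le => [|i _]; first by have [] := S_le 0%N isT.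
  by have [] := S_le i (leq_ord i).
have [_ <-//] := S_le n (leqnn n).
rewrite /Smax big_mkord; exact: (le_bigmax _ _ (@ord_max n)).
Qed.

(** Below [alpha_star] both statistics are the same inverse. Above it only k = 1 remains, where
    [alpha_star] is 0 and both equal alpha / n. *)
Lemma qhat_gf_eq (R : realType) n k (alpha : R) : 0 <= alpha <= 1 ->
  (k <= n)%N -> (k <= 1)%N \/ alpha <= alpha_star k n ->
  qhat_g alpha k n = qhat_f alpha k n.
Proof.
move=> a01; have /andP[a0 a1] := a01.
case: k => [|k] kn kcase; first by rewrite /qhat_g /qhat_f eqxx.
case: n kn kcase => [|n] kn kcase; first by exfalso; rewrite ltn0 in kn.
rewrite ltnS in kn.
have kE : k.+1%:Z - 1 = k%:Z by rewrite intS addrC addKr.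
rewrite /qhat_g /qhat_f kE /= alpha_daggerE.
have n0 : n.+1%:R != 0 :> R by rewrite pnatr_eq0.
have b0 : 1 - alpha_star k.+1 n.+1 != 0 :> R.
  by rewrite subr_eq0 gt_eqF// alpha_star_lt1.
have kR : k%:R + 1 = k.+1%:R :> R by rewrite natr1.
have nkR : n.+1%:R - k%:R = n.+1%:R - k.+1%:R + 1 :> R.
  by rewrite -[k.+1%:R]natr1; ring.
have [aa|aa|aa] := ltgtP alpha (alpha_star k.+1 n.+1).
- by rewrite kR nkR.
- have {kcase} k0 : k = 0%N.
    by case: kcase => [|/le_lt_trans/(_ aa)]; rewrite ?ltxx// ltnS leqn0 => /eqP.
  move: aa b0; rewrite k0 subn0 subn1 /= Smax_pred// alpha_starE// mul0r binom_lt_0.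
  by rewrite subrr subr0 => _ _; move: n0; set N := n.+1%:R => N0; field.
- rewrite kR nkR aa; have aa01 : 0 <= (alpha_star k.+1 n.+1 : R) <= 1 by rewrite -aa.
  have [x01 xE] := inc_beta_inv_binom_lt R _ k n kn aa01.
  (* At equality [qhat_g] takes its affine branch and [qhat_f] the inverse; both give the point
     defining [alpha_star]. *)
  transitivity (k%:R / n.+1%:R : R).
    rewrite -[k.+1%:R]natr1; move: b0 n0; set b := alpha_star _ _.
    by set N := n.+1%:R => b0 N0; field; apply/andP.
  apply: (binom_lt_inj _ k n) => //.
    by rewrite divr_ge0//= ler_pdivrMr ?ltr0n// mul1r ler_nat ltnW.
  by rewrite xE alpha_starE// subKr.
Qed.

Theorem corollary1 (R : realType) (disp : measure_display)
    (Omega : measurableType disp) (P : probability Omega R)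
    (n : nat) (hn : (1 <= n)%N)
    (T : 'I_n -> {RV P >-> bool}) (q : 'I_n -> R)
    (hq : forall i : 'I_n, 0 <= q i <= 1)
    (hT : forall i : 'I_n, P [set w | T i w = true] = (q i)%:E)
    (hind : mutually_independent T)
    (alpha : R) (halpha : 0 <= alpha <= 1) :
  let qbar : R := (\sum_(i < n) q i) / n%:R in
  let nTbar : Omega -> nat := successes T in
  [/\ ((1 - alpha)%:E <= P [set w | (qhat_g alpha (nTbar w) n <= qbar)%R])%E,
      ((1 - alpha)%:E <=
         P [set w | (qbar <= 1 - qhat_g alpha (n - nTbar w)%N n)%R])%E,
      (forall k : nat, (k <= n)%N ->
         (k <= 1)%N \/ alpha <= alpha_star k n ->
         qhat_g alpha k n = qhat_f alpha k n) &
      (alpha <= 1 / 4 ->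
         forall k : nat, (k <= n)%N -> qhat_g alpha k n = qhat_f alpha k n)].
Proof.
move=> qbar nTbar; have /andP[a0 a1] := halpha.
have n0 : (n%:R : R) != 0 by rewrite pnatr_eq0 -lt0n.
have c1 : 1 - alpha <= 1 by rewrite gerDl oppr_le0.
have Nle w : (nTbar w <= n)%N.
  rewrite -[leqRHS]card_ord -sum1_card; apply: leq_sum => i _.
  by case: (T i w).
have gf k : (k <= n)%N -> (k <= 1)%N \/ alpha <= alpha_star k n ->
    qhat_g alpha k n = qhat_f alpha k n by exact: qhat_gf_eq.
split=> //.
- apply: (minimal_index_coverage _ _ _ _ n nTbar (fun k => qhat_g alpha k n)) => //.
    by move=> Q; exact: measurable_successes.
  move=> k kn qk; rewrite (prob_successes_lt _ _ _ _ _ _ q)// lee_fin.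
  exact: (qhat_g_coef_below R n).
(* The second inequality is the lower bound for failures, whose mean probability is 1 - [qbar]. *)
- pose q' i := 1 - q i.
  have q'01 : unit_box q'.
    by move=> i; have /andP[? ?] := hq i; rewrite /q' subr_ge0 gerBl; apply/andP.
  have q'bar : (\sum_i q' i) / n%:R = 1 - qbar.
    by rewrite sumrB sumr_const card_ord mulrBl divff.
  rewrite (_ : [set w | _] = [set w | (qhat_g alpha (n - nTbar w) n <= 1 - qbar)%R]).
    apply: (minimal_index_coverage _ _ _ _ n (fun w => n - nTbar w)%N
      (fun k => qhat_g alpha k n)) => //.
    + by move=> w; exact: leq_subr.
    + move=> Q; exact: (measurable_successes _ _ _ _ _ T (fun m => Q (n - m)%N)).
    + move=> k kn qk; rewrite (prob_failures_lt _ _ _ _ _ _ q)// lee_fin.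
      by apply: (qhat_g_coef_below R n) => //; rewrite q'bar.
  by apply/seteqP; split => w /= h; rewrite lerBrDr addrC -lerBrDr.
- move=> a14 k kn; apply: gf => //.
  case: k kn => [|[|k]] kn; [by left|by left|right].
  by apply: le_trans a14 _; exact: alpha_star_ge14.
Qed.
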